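(* Let $X$ be an even-dimensional real vector space with a symplectic form $\omega$, and let $K\subseteq X$ be a smooth convex body containing the origin in its interior. Let $c:\mathbb{S}^1\to\partial K$ be a differentiable, regular, simple curve which is positively parametrized. Then $c$ is a closed characteristic of $\partial K$ if and only if $$2A(c)=L_\omega(c),$$ where $A(c)=\frac12\int_{\mathbb{S}^1}\omega(c'(t),c(t))\,dt$ is the symplectic area of $c$ and $L_\omega(c)=\int_{\mathbb{S}^1}\gamma_\omega(c'(t))\,dt$ is the length of $c$ in the geometry given by the dual gauge $\gamma_\omega$ of the gauge $\gamma=\gamma_K$.
   Context: All vector spaces are finite-dimensional. A convex body is a compact convex set with non-empty interior; it is smooth if at each boundary point it is supported by exactly one hyperplane. For a convex body $K$ with $0\in\mathrm{int}\,K$, its gauge is $\gamma_K(x)=\inf\{\lambda\ge0:x\in\lambda K\}$. A symplectic form $\omega$ is a nondegenerate skew-symmetric bilinear form on $X$. It gives an isomorphism $\mathcal{I}:X^*\to X$ determined by $f(\cdot)=\omega(\mathcal{I}(f),\cdot)$. With $K^\circ=\{f\in X^*: f(x)\le1\ \forall x\in K\}$, the dual body is $K^\omega=\mathcal{I}(K^\circ)$, and the dual gauge of $\gamma_K$ is $\gamma_\omega(x)=\inf\{\lambda\ge0:x\in\lambda K^\omega\}$. For non-zero $v\in X$ put $\{v\}^\perp=\{z\in X:\omega(v,z)=0\}$. For $x\in\partial K$, $Jx$ denotes the unique vector such that the affine hyperplane $x+\{Jx\}^\perp$ supports $K$ at $x$ and $\omega(Jx,x)=1$. A differentiable curve $c$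 is regular if $c'(t)\ne0$ for all $t$, simple if it has no self-intersections, and a differentiable, regular curve $c:\mathbb{S}^1\to\partial K$ is positively parametrized if $\omega(c'(t),c(t))>0$ for all $t\in\mathbb{S}^1$. The characteristics of $\partial K$ are the integral curves of the field of directions given by $Jx$, $x\in\partial K$, i.e. the curves on $\partial K$ tangent to the direction $Jx$ at each of their points $x$; a characteristic is closed if it is a closed curve, i.e. admits a parametrization $c:\mathbb{S}^1\to\partial K$. *)

(* Defs.v *)
From HB Require Import structures.
From mathcomp Require Import all_boot all_order all_algebra.
From mathcomp Require Import all_classical all_reals all_analysis.

Set Implicit Arguments.
Unset Strict Implicit.
Unset Printing Implicit Defensive.

Import Order.TTheory GRing.Theory Num.Theory.
Import numFieldNormedType.Exports.

Local Open Scope classical_set_scope.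
Local Open Scope ring_scope.

(* The norm only carries the canonical topology of a finite-dimensional real
   vector space: nothing below mentions it, and all norms are equivalent. *)
#[short(type="normedVectType")]
HB.structure Definition NormedVector (R : numDomainType) :=
  {V of NormedModule R V & Vector R V}.

Section ConvexBodies.
Variables (R : realType) (X : normedVectType R).
Implicit Types (K H : set X) (x : X).

Definition boundary K : set X := closure K `\` K°.

Definition convex_body K : Prop :=
  [/\ compact K, convex_set K & K° !=set0].

Definition supports K x H : Prop :=
  K x /\ exists2 f : 'Hom(X, R^o), f != 0 &
    H = [set z | f z = f x] /\ forall y, K y -> (f y : R) <= f x.

Definition smooth_body K : Prop :=
  forall x, boundary K x -> exists! H, supports K x H.

Definition gauge K x : R :=
  inf [set l : R | 0 <= l /\ exists2 y, K y & x = l *: y].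

Definition polar K : set 'Hom(X, R^o) :=
  [set f | forall x, K x -> (f x : R) <= 1].

End ConvexBodies.

Section Symplectic.
Variables (R : realType) (X : normedVectType R) (omega : {skew_symmetric X}).
Implicit Types (K : set X) (x v : X) (c : R -> X).

(* The isomorphism from X^* to X; the default value 0 is irrelevant, since
   for nondegenerate [omega] there is exactly one such [v]. *)
Definition sharp (f : 'Hom(X, R^o)) : X :=
  xget 0 [set v | forall x, f x = omega v x].

Definition dual_body K : set X := [set sharp f | f in polar K].

Definition dual_gauge K : X -> R := gauge (dual_body K).

Definition orth v : set X := [set z | omega v z = 0].

(* Only meaningful on the boundary of a smooth convex body with 0 in its
   interior, where exactly one such [v] exists. *)
Definition J K x : X :=
  xget 0 [set v | supports K x [set x + z | z in orth v] /\ omega v x = 1].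

(* Curves on the circle are (2 pi)-periodic maps on the real line, the circle
   being the quotient R / (2 pi Z). *)
Definition circle_map c : Prop := periodic c (2 * pi).

Definition differentiable_curve c : Prop := forall t, derivable c t 1.

Definition regular_curve c : Prop := forall t, 'D_1 c t != 0.

Definition simple_curve c : Prop :=
  {in `[0, 2 * pi[ &, injective c}.

Definition positively_parametrized c : Prop :=
  forall t, 0 < omega ('D_1 c t) (c t).

Definition closed_characteristic K c : Prop :=
  [/\ circle_map c, differentiable_curve c, regular_curve c,
      forall t, boundary K (c t) &
      forall t, 'D_1 c t \in <[J K (c t)]>%VS].

Definition symplectic_area c : R :=
  2^-1 * \int[lebesgue_measure]_(t in `[0, 2 * pi]) omega ('D_1 c t) (c t).

(* The derivative of a merely differentiable curve need not be integrable, so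
   the length takes its values in [0, +oo]. *)
Definition dual_length K c : \bar R :=
  (\int[lebesgue_measure]_(t in `[0%R, (2 * pi)%R])
     (dual_gauge K ('D_1 c t))%:E)%E.

End Symplectic.

(* Main.v *)
Require Import Defs.
From HB Require Import structures.
From mathcomp Require Import all_boot all_order all_algebra.
From mathcomp Require Import all_classical all_reals all_analysis.
From mathcomp Require Import measurable_realfun.
From mathcomp Require Import ring lra.

Set Implicit Arguments.
Unset Strict Implicit.
Unset Printing Implicit Defensive.

Import Order.TTheory GRing.Theory Num.Theory.
Import numFieldNormedType.Exports.
Import VectorInternalTheory.

Local Open Scope classical_set_scope.
Local Open Scope ring_scope.

(** Put [f t = omega (c' t) (c t) > 0] and let [g t] be the dual gauge of
    [c' t], i.e. the maximum of [omega (c' t)] on [K]; thus [f <= g].  The curve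
    is a characteristic iff [c t] maximizes [omega (c' t)] on [K] for all [t],
    i.e. iff [f = g] everywhere.

    As [c'] need not be integrable, two points require care.  If [f = g], then
    near [p] the function [f] is at most twice the derivative of the monotone
    function [omega (c t) (c p)], so Fatou's lemma shows that the area is
    finite.  Conversely, equality of the integrals gives
    [omega (c' t) y <= f t] only for almost every [t], for each [y] in [K].  To
    reach a given [t0], consider [(1 + e) omega (c t) (c t0) - omega (c t) y]:
    its derivative is nonnegative almost everywhere near [t0], hence it is
    monotone by the Goldowsky-Tonelli theorem, and its derivative at [t0] is
    nonnegative; then let [e] tend to 0. *)

(** * Boundedness and continuity of linear maps in finite dimension *)

Lemma linear_rV_bounded (R : realType) (n : nat) (V : normedModType R)
    (g : {linear 'rV[R]_n -> V}) :
  exists2 C : R, 0 < C & forall u, `|g u| <= C * `|u|.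
Proof.
exists (1 + \sum_i `|g (delta_mx 0 i)|).
  by rewrite ltr_pwDl// sumr_ge0.
move=> u; rewrite {1}(row_sum_delta u) linear_sum/= mulrDl mul1r.
apply: le_trans (ler_norm_sum _ _ _) _.
apply: le_trans (_ : \sum_i `|g (delta_mx 0 i)| * `|u| <= _); last first.
  by rewrite mulr_suml lerDr.
apply: ler_sum => i _; rewrite linearZ/= normrZ mulrC ler_wpM2l//.
rewrite [leRHS]/Num.norm/= mx_normrE.
by apply/bigmax_geP; right => /=; exists (ord0, i).
Qed.

(** On the compact unit sphere of the coordinate space the continuous function [|r2v u|] attains its
    minimum, which is positive because [r2v] is injective; its inverse is the constant. *)
Lemma v2r_bounded (R : realType) (X : normedVectType R) :
  exists2 C : R, 0 < C & forall x : X, `|v2r x| <= C * `|x|.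
Proof.
have [B B0 hB] := linear_rV_bounded (@r2v R X).
pose S := [set u : 'rV[R]_(dim X) | `|u| = 1].
have cS : compact S.
  apply: bounded_closed_compact.
    by exists 1; split => // y y1 u /= ->; exact: ltW.
  have -> : S = Num.norm @^-1` [set 1] by [].
  apply: closed_comp; last exact: (@closed_eq R 1).
  by move=> u _; exact: norm_continuous.
have cr : continuous (fun u : 'rV[R]_(dim X) => `|r2v u : X|).
  move=> u; apply: continuous_comp; last exact: norm_continuous.
  apply: bounded_linear_continuous.
  apply/linear_boundedP.
  exists B; split=> [|r Br x]; first exact: gtr0_real.
  by apply: le_trans (hB x) _; rewrite ler_wpM2r// ltW.
(* The sphere is empty in dimension 0, where every coordinate vector is 0. *)
have [S0|] := pselect (S !=set0); last first.
  move=> S0; exists 1 => // x; rewrite mul1r.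
  have [->|vx] := eqVneq (v2r x) 0; first by rewrite normr0.
  exfalso; apply: S0; exists (`|v2r x|^-1 *: v2r x); rewrite /S/= normrZ.
  by rewrite normfV normr_id mulVf// normr_eq0.
have [u Su hu] := @EVT_min_rV _ _ _ _ S0 cS (continuous_subspaceT cr).
have m0 : 0 < `|r2v u : X|.
  rewrite normr_gt0; apply/eqP => u0.
  move: Su; rewrite inE /S/= -(r2vK u) u0 linear0 normr0 => /esym/eqP.
  by rewrite oner_eq0.
exists `|r2v u : X|^-1; first by rewrite invr_gt0.
move=> x; have [->|vx] := eqVneq (v2r x) 0.
  by rewrite normr0 mulr_ge0// invr_ge0.
rewrite mulrC ler_pdivlMr//.
have /hu : `|v2r x|^-1 *: v2r x \in S.
  by rewrite inE /S/= normrZ normfV normr_id mulVf// normr_eq0.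
by rewrite linearZ/= v2rK normrZ normfV normr_id ler_pdivlMl// normr_gt0.
Qed.

Lemma linear_bounded (R : realType) (X : normedVectType R)
    (f : {linear X -> R^o}) :
  exists2 C : R, 0 < C & forall x : X, `|f x : R| <= C * `|x|.
Proof.
have [C C0 hC] := @v2r_bounded R X.
have [D D0 hD] := linear_rV_bounded (f \o (@r2v R X)).
exists (D * C); first exact: mulr_gt0.
move=> x; rewrite -{1}(v2rK x); apply: le_trans (hD (v2r x)) _.
by rewrite -mulrA ler_wpM2l// ltW.
Qed.

Lemma linear_continuous_vect (R : realType) (X : normedVectType R)
    (f : {linear X -> R^o}) : continuous f.
Proof.
have [C C0 hC] := linear_bounded f.
apply: bounded_linear_continuous; apply/linear_boundedP.
exists C; split=> [|r Cr x]; first exact: gtr0_real.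
by apply: le_trans (hC x) _; rewrite ler_wpM2r// ltW.
Qed.

(** * Monotonicity from an almost everywhere nonnegative derivative *)

(** Cover [N] by open sets [G n] of measure at most [e / 2 ^ n.+1] and let [s x] be the sum of the
    measures of [G n] to the left of [x]. Near a point of [N] each of the first [k] sets contributes
    slope 1, so the slope exceeds any [M]. *)
Lemma negligible_slope_function (R : realType) (N : set R) (e : R) :
    lebesgue_measure.-negligible N -> 0 < e ->
  exists s : R -> R, [/\ {homo s : x y / x <= y},
    forall x, 0 <= s x <= e &
    forall x, N x -> forall M, \forall y \near x^'+, M * (y - x) <= s y - s x].
Proof.
move=> /negligible_outer_measure N0 e0.
have e2 n : 0 < e / (2 ^ n.+1)%:R by rewrite divr_gt0.
have /choice[G hG] : forall n, exists U : set R, [/\ open U, N `<=` U &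
    (lebesgue_measure U <= (e / (2 ^ n.+1)%:R)%:E)%E].
  move=> n; have [U [oU NU]] := outer_measure_open_le N (e2 n).
  by rewrite N0 add0e; exists U.
have oG n : open (G n) by case: (hG n).
have mG n : measurable (G n) by exact: open_measurable.
pose nu : {measure set (measurableTypeR R) -> \bar R} :=
    mseries (fun n => mrestr lebesgue_measure (mG n)) 0.
have nu_e A : measurable A -> (nu A <= e%:E)%E.
  move=> mA; apply: le_trans (epsilon_trick0 predT (ltW e0)).
  rewrite /nu /= /mseries; apply: lee_nneseries => // n _.
  case: (hG n) => _ _; apply: le_trans.
  apply: le_measure; rewrite ?inE; last exact: subIsetr.
    by apply: measurableI; [exact: mA|exact: mG].
  exact: mG.
have nu_fin A : measurable A -> nu A \is a fin_num.
  by move=> mA; rewrite ge0_fin_numE// (le_lt_trans (nu_e _ mA))// ltry.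
pose s x := fine (nu `]-oo, x]%classic).
have sB x y : x <= y -> s y - s x = fine (nu `]x, y]%classic).
  move=> xy; have yE : `]-oo, y]%classic = `]-oo, x]%classic `|` `]x, y]%classic.
    apply/seteqP; split=> z /=; rewrite !in_itv/=.
      by move=> ->; case: (leP z x); [left|right].
    by case=> [/le_trans->//|/andP[]].
  rewrite /s yE measureU//; last first.
    rewrite -subset0 => z []/=; rewrite !in_itv/= => zx /andP[].
    by rewrite ltNge zx.
  by rewrite fineD ?nu_fin// addrAC subrr add0r.
exists s; split.
- by move=> x y xy; rewrite -subr_ge0 sB// fine_ge0.
- move=> x; rewrite fine_ge0//=.
  by rewrite -lee_fin fineK ?nu_fin// nu_e.
move=> x Nx M.
have [k Mk] : exists k : nat, M <= k%:R.
  by exists (Num.bound `|M|); rewrite (le_trans (ler_norm _))// ltW// archi_boundP.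
have nG : nbhs x (fun y => forall n : 'I_k, G n y).
  apply: (@filter_forall _ _ (fun n : 'I_k => G n) (nbhs x) _) => n.
  by case: (hG n) => /= + NG _ => /(_ x (NG _ Nx)).
have [r /= r0 hr] := nG.
near=> y.
have xy : x < y by near: y; exact: nbhs_right_gt.
rewrite sB ?(ltW xy)// -lee_fin fineK ?nu_fin//.
apply: le_trans (_ : (\sum_(0 <= n < k) mrestr lebesgue_measure (mG n) `]x, y]%classic <= _)%E);
  last by apply: nneseries_lim_ge.
rewrite (eq_big_nat _ _ (F2 := fun=> (y - x)%:E)); last first.
  move=> n /andP[_ nk]; rewrite /mrestr setIidl; last first.
    move=> z /=; rewrite in_itv/= => /andP[xz zy].
    apply: (hr z _ (Ordinal nk)); rewrite /= ltr0_norm ?subr_lt0// opprB.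
    rewrite ltrBlDl (le_lt_trans zy)//; near: y.
    by apply: nbhs_right_lt; rewrite ltrDl.
  by rewrite lebesgue_measure_itv/= lte_fin xy.
rewrite sumEFin lee_fin big_const_nat subn0 iter_addr addr0 -[leRHS]mulr_natl.
by rewrite ler_wpM2r// subr_ge0 ltW.
Unshelve. all: by end_near. Qed.

Lemma derivable_right_slope (R : realType) (f : R -> R) (x m : R) :
  derivable f x 1 -> m < 'D_1 f x ->
  \forall y \near x^'+, m * (y - x) <= f y - f x.
Proof.
move=> df mD.
have : \forall h \near (0:R)^', m < h^-1 *: (f (h *: 1 + x) - f x).
  exact: (cvgr_gt _ df).
move=> [r /= r0 hr]; near=> y.
have xy : x < y by near: y; exact: nbhs_right_gt.
have := hr (y - x); rewrite /= sub0r normrN gtr0_norm ?subr_gt0//.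
rewrite subr_eq0 gt_eqF// => /(_ _ isT).
rewrite /GRing.scale /= mulr1 subrK => H.
rewrite -ler_pdivlMr ?subr_gt0// mulrC; apply/ltW/H.
rewrite ltrBlDl; near: y; apply: nbhs_right_lt; by rewrite ltrDl.
Unshelve. all: by end_near. Qed.

(* Goldowsky-Tonelli: adding to [h] a small monotone function of infinite slope
   on the exceptional set makes all right lower derivates nonnegative. *)
Lemma ae_ger0_derive_ndecr (R : realType) (h : R -> R) (N : set R) (a b : R) :
    a <= b -> lebesgue_measure.-negligible N ->
    (forall x, x \in `[a, b] -> derivable h x 1) ->
    (forall x, x \in `[a, b] -> ~ N x -> 0 <= 'D_1 h x) ->
  h a <= h b.
Proof.
move=> ab N0 dh h'0; apply/ler_addgt0Pr => e0 e0_gt0.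
(* Over [[a, b]] the perturbation grows by at most [e] from [s] and [e * (b - a)] from the linear
   term, in total [e0]. *)
pose e := e0 / (1 + (b - a)).
have d0 : 0 < 1 + (b - a) by rewrite ltr_wpDr// subr_ge0.
have e_gt0 : 0 < e by rewrite divr_gt0.
have [s [s_nd s_e sN]] := negligible_slope_function N0 e_gt0.
pose phi x := h x + s x + e * x.
suff : phi a <= phi b.
  rewrite /phi => H; have /andP[sa _] := s_e a; have /andP[_ sb] := s_e b.
  have -> : e0 = e * (1 + (b - a)) by rewrite /e divfK// gt_eqF.
  lra.
have phi_right t : t \in `[a, b] -> \forall y \near t^'+, phi t <= phi y.
  move=> tab; have [Nt|Nt] := pselect (N t).
    (* The slope of [h] is eventually at least ['D_1 h t - 1]; the infinite slope of [s], used with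
       [M = 1 - 'D_1 h t], cancels it. *)
    have hm : 'D_1 h t - 1 < 'D_1 h t by rewrite ltrBlDr ltrDl.
    near=> y.
    have ty : t < y by near: y; exact: nbhs_right_gt.
    have H1 : ('D_1 h t - 1) * (y - t) <= h y - h t.
      by near: y; apply: derivable_right_slope => //; exact: dh.
    have H2 : (1 - 'D_1 h t) * (y - t) <= s y - s t by near: y; exact: sN.
    have := ltW ty; rewrite -(ler_pM2l e_gt0) /phi => H3.
    by move: H1 H2 H3; lra.
  have hm : - e < 'D_1 h t.
    by rewrite (lt_le_trans _ (h'0 _ _ Nt))// oppr_lt0.
  near=> y.
  have ty : t <= y by near: y; exact: nbhs_right_ge.
  have H1 : - e * (y - t) <= h y - h t.
    by near: y; apply: derivable_right_slope => //; exact: dh.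
  have := s_nd _ _ ty; rewrite /phi; move: H1; lra.
pose S := [set x | x \in `[a, b] /\ phi a <= phi x].
have aS : S a by split=> //; rewrite bound_itvE.
have ubS : ubound S b by move=> x [/itvP ->].
have hS : has_sup S by split; [exists a|exists b].
have aS_le : a <= sup S by apply: ub_le_sup => //; case: hS.
have Sb_le : sup S <= b by apply: ge_sup => //; case: hS.
have Sab : sup S \in `[a, b] by rewrite in_itv/= aS_le.
(* The supremum is approached from the left: [h] is continuous there, and the monotone [s] can only
   jump upwards. *)
have SS : phi a <= phi (sup S).
  apply/ler_addgt0Pr => d d0'.
  have ch : {for sup S, continuous h}.
    by apply: differentiable_continuous; apply/derivable1_diffP; exact: dh.
  have /cvgrPdist_lt/(_ _ d0')[r /= r0 hr] := ch.
  have [x Sx xr] := sup_adherent r0 hS.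
  have xS : x <= sup S by apply: ub_le_sup => //; case: hS.
  have := hr x; rewrite /ball/= ger0_norm ?subr_ge0// => /(_ _).
  have xr' : sup S - x < r by lra.
  move=> /(_ xr'); rewrite ltr_norml => /andP[h1 _].
  have h2 := s_nd _ _ xS.
  have h3 : e * x <= e * sup S by rewrite ler_pM2l.
  by case: Sx => _; move: h1 h2 h3; rewrite /phi; lra.
have [/eqP <-//|Snb] := boolP (sup S == b).
have Slt : sup S < b by rewrite lt_neqAle Snb.
exfalso.
suff [y [Sy ybS]] : exists y, sup S < y /\ S y.
  by have := ub_le_sup (proj2 hS) ybS; rewrite leNgt Sy.
near (sup S)^'+ => y; exists y.
have Sy : sup S < y by near: y; exact: nbhs_right_gt.
split=> //; split.
  rewrite in_itv/= (le_trans aS_le (ltW Sy))/=.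
  by near: y; exact: nbhs_right_le.
by apply: le_trans SS _; near: y; exact: phi_right.
Unshelve. all: by end_near. Qed.

(** * Difference quotients; measurability and integrability of derivatives *)

Lemma continuous_difference_quotient (R : realType) (f : R -> R) (k u : R) :
  continuous f -> continuous (fun x => k * (f (x + u) - f x)).
Proof.
move=> cf x; apply: cvgM; first exact: cvg_cst.
apply: cvgB; last exact: cf.
apply: (@cvg_comp _ _ _ (fun y => y + u) f _ (nbhs (x + u))); last exact: cf.
by apply: cvgD; [exact: cvg_id|exact: cvg_cst].
Qed.

Lemma is_derive_difference_quotient (R : realType) (f : R -> R)
    (k u x d1 d2 : R) :
  is_derive x 1 f d1 -> is_derive (x + u) 1 f d2 ->
  is_derive x 1 (fun x => k * (f (x + u) - f x)) (k * (d2 - d1)).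
Proof.
move=> H1 H2.
have := @is_derive1_comp _ f _ x _ _ H2 (is_derive_shift x 1 u).
rewrite mulr1 => H3.
exact: (is_deriveZ k (@is_deriveB _ _ _ _ _ x _ _ _ H3 H1)).
Qed.

Lemma derive_seq_cvg (R : realType) (f : R -> R) (x : R) (u : R^nat) :
    derivable f x 1 -> (forall n, u n != 0) -> u @ \oo --> 0 ->
  (u n)^-1 * (f (x + u n) - f x) @[n --> \oo] --> 'D_1 f x.
Proof.
move=> df u0 u_0.
have /cvgr_dnbhsP/(_ u (conj u0 u_0)) := df.
have -> : (fun n => (u n)^-1 * (f (x + u n) - f x)) =
    (fun n => (u n)^-1 *: (((f \o shift x) (u n *: 1)) - f x)).
  by apply/funext => n; rewrite /= /GRing.scale/= mulr1 [x + _]addrC.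
by apply.
Qed.

Lemma measurable_derive (R : realType) (f : R -> R) (D : set R) :
  measurable D -> (forall x, derivable f x 1) ->
  measurable_fun D (fun x => 'D_1 f x).
Proof.
move=> mD df.
have cf : continuous f.
  by move=> x; apply: differentiable_continuous; exact/derivable1_diffP.
apply: (@measurable_fun_cvg _ _ _ D
  (fun n x => (n.+1%:R^-1)^-1 * (f (x + n.+1%:R^-1) - f x))); last first.
  move=> x _; apply: (@derive_seq_cvg _ f x (fun n => n.+1%:R^-1)) => //.
  exact: cvg_harmonic.
move=> n; apply: measurable_funTS; apply: continuous_measurable_fun.
exact: continuous_difference_quotient.
Qed.

Lemma continuous_primitive (R : realType) (f : R -> R) (a b : R) :
  continuous f -> a < b ->
  exists G : R -> R, forall x, x \in `]a, b[ -> is_derive x 1 G (f x).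
Proof.
move=> cf ab.
exists (fun x => \int[lebesgue_measure]_(t in `[a, x]) f t)%R => x.
rewrite in_itv/= => /andP[ax xb].
have fi : lebesgue_measure.-integrable `[a, b] (EFin \o f).
  apply: continuous_compact_integrable; first exact: segment_compact.
  exact: continuous_subspaceT.
have [dG G'] := continuous_FTC1_closed xb fi ax (cf x).
by apply: DeriveDef; [exact: dG|rewrite -derive1E; exact: G'].
Qed.

Lemma MVT_quotient (R : realType) (G F : R -> R) (x u : R) : 0 < u ->
    (forall y, y \in `[x, x + u] -> is_derive y 1 G (F y)) ->
  exists2 y, x <= y <= x + u & u^-1 * (G (x + u) - G x) = F y.
Proof.
move=> u0 dG; have xu : x < x + u by rewrite ltrDl.
have dG' y : y \in `]x, x + u[ -> is_derive y 1 G (F y).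
  by move=> xy; apply: dG; exact: subset_itv_oo_cc xy.
have cG : {within `[x, x + u], continuous G}.
  by apply: derivable_within_continuous => z /dG[].
have [y yI Py] := MVT xu dG' cG; exists y.
  by move: (subset_itv_oo_cc yI); rewrite in_itv.
by rewrite Py [x + _]addrC addrK mulrC mulfK// gt_eqF.
Qed.

(* Fatou's lemma for the difference quotients, whose integrals telescope
   through a primitive of [F]. *)
Lemma ge0_derive_integral_lty (R : realType) (F : R -> R) (a b d : R) :
    a < b -> b < d -> (forall x, derivable F x 1) ->
    (forall x, x \in `[a, d] -> 0 <= 'D_1 F x) ->
  (\int[lebesgue_measure]_(x in `[a, b]) ('D_1 F x)%:E < +oo)%E.
Proof.
move=> ab bd dF F'0.
have cF : continuous F.
  by move=> x; apply: differentiable_continuous; exact/derivable1_diffP.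
have Fnd x y : a <= x -> x <= y -> y <= d -> F x <= F y.
  move=> ax xy yd.
  apply: (@ger0_derive1_ndecr _ F a d) => // [z zad|].
    by rewrite derive1E; apply: F'0; exact: subset_itv_oo_cc.
  exact: continuous_subspaceT.
have ad : a - 1 < d + 1 by lra.
have [G dG] := continuous_primitive cF ad.
(* The steps tend to 0 and keep [x + u n] inside [[a, d]] for every [x] in [[a, b]]. *)
pose u n := (d - b) * n.+1%:R^-1 : R.
have bd0 : 0 < d - b by rewrite subr_gt0.
have u_gt0 n : 0 < u n by rewrite mulr_gt0// invr_gt0.
have u_le n : u n <= d - b by rewrite /u -[leRHS]mulr1 ler_pM2l// invf_le1// ler1n.
have u0 : u @ \oo --> 0.
  rewrite -[0](mulr0 (d - b)); apply: cvgM; first exact: cvg_cst.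
  exact: cvg_harmonic.
pose q n x := (u n)^-1 * (F (x + u n) - F x).
have cq n : continuous (q n) by exact: continuous_difference_quotient.
have q0 n x : x \in `[a, b] -> 0 <= q n x.
  rewrite in_itv/= => /andP[ax xb]; have un := u_gt0 n; have := u_le n => un'.
  by apply: mulr_ge0; [rewrite invr_ge0 ltW|rewrite subr_ge0; apply: Fnd; lra].
(* The integral is [P b - P a], a difference of two averages of [F]. By the mean value theorem these
   are values of [F] on [[a, d]], so monotonicity bounds the difference uniformly in [n]. *)
have iq n : (\int[lebesgue_measure]_(x in `[a, b]) (q n x)%:E
              <= (F d - F a)%:E)%E.
  have un := u_gt0 n; have un' := u_le n.
  pose P x := (u n)^-1 * (G (x + u n) - G x).
  have dP x : x \in `[a, b] -> is_derive x 1 P (q n x).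
    rewrite in_itv/= => /andP[ax xb].
    have d1 : is_derive x 1 G (F x) by apply: dG; rewrite in_itv/=; lra.
    have d2 : is_derive (x + u n) 1 G (F (x + u n)).
      by apply: dG; rewrite in_itv/=; lra.
    exact: is_derive_difference_quotient.
  have cP x : x \in `[a, b] -> {for x, continuous P}.
    move=> /dP; case=> dPx _.
    by apply: differentiable_continuous; exact/derivable1_diffP.
  rewrite (@continuous_FTC2 _ (q n) P)//.
  - rewrite -EFinB lee_fin.
    have mvt x : a <= x -> x <= b ->
        exists2 y, x <= y <= x + u n & P x = F y.
      move=> ax xb.
      have dGx z : z \in `[x, x + u n] -> is_derive z 1 G (F z).
        by rewrite in_itv/= => zx; apply: dG; rewrite in_itv/=; lra.
      have [y yx Py] := @MVT_quotient _ G F x (u n) un dGx.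
      by exists y.
    have [y yb ->] : exists2 y, b <= y <= b + u n & P b = F y by apply: mvt; lra.
    have [z za ->] : exists2 z, a <= z <= a + u n & P a = F z by apply: mvt; lra.
    by apply: lerB; apply: Fnd; lra.
  - exact: continuous_subspaceT.
  - split=> [x xab||].
    + by have [] := dP _ (subset_itv_oo_cc xab).
    + by apply/cvg_at_right_filter/cP; rewrite bound_itvE ltW.
    + by apply/cvg_at_left_filter/cP; rewrite bound_itvE ltW.
  - move=> x xab; have [? <-] := dP _ (subset_itv_oo_cc xab).
    by rewrite derive1E.
have -> : (\int[lebesgue_measure]_(x in `[a, b]) ('D_1 F x)%:E =
    \int[lebesgue_measure]_(x in `[a, b]) limn_einf (fun n => (q n x)%:E))%E.
  apply: eq_integral => x _; apply/esym.
  have H : (q n x)%:E @[n --> \oo] --> ('D_1 F x)%:E.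
    apply: cvg_EFin; first by near=> n.
    apply: derive_seq_cvg => // n; by rewrite gt_eqF.
  by have [-> _] := cvg_limn_einf_sup H.
apply: le_lt_trans (ltry (F d - F a)).
apply: (@le_trans _ _ (limn_einf (fun n =>
    \int[lebesgue_measure]_(x in `[a, b]) (q n x)%:E)))%E.
  apply: fatou => // n; apply/measurable_EFinP; apply: measurable_funTS.
  exact: continuous_measurable_fun.
rewrite limn_einf_lim; apply: lime_le; first exact: is_cvg_einfs.
apply: nearW => n; apply: le_trans (iq n).
by apply: ereal_inf_lbound; exists n => /=.
Unshelve. all: by end_near. Qed.

Lemma is_derive_linear (R : realType) (X : normedVectType R)
    (f : {linear X -> R^o}) (c : R -> X) (t : R) :
  derivable c t 1 -> is_derive t 1 (fun s => f (c s) : R) (f ('D_1 c t)).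
Proof.
move=> dc.
suff H : h^-1 *: ((f \o c \o shift t) (h *: 1) - f (c t)) @[h --> 0^'] -->
    (f ('D_1 c t) : R^o).
  apply: DeriveDef.
    by apply/cvg_ex; exists (f ('D_1 c t)); exact: H.
  by apply: cvg_lim => //; exact: H.
rewrite [X in X @ _](_ : _ =
    f \o (fun h : R => h^-1 *: ((c \o shift t) (h *: 1) - c t))); last first.
  by apply/funext => h /=; rewrite linearZ/= (linearB f).
by apply: (cvg_comp _ _ dc); exact: linear_continuous_vect.
Qed.

(** * Symplectic pairing, dual gauge and the vector [J x] *)

Section SymplecticPairing.
Variables (R : realType) (X : normedVectType R) (omega : {skew_symmetric X}).
Implicit Types (v x y : X) (K : set X).

(** The two partial applications of [omega] are named so that each carries a linear structure with
    values in [R^o]. *)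
Definition pairing v x : R^o := omega v x.
Definition rpairing x v : R^o := omega v x.

Fact pairing_linear v : linear (pairing v).
Proof. by move=> k x y; rewrite /pairing linearDr linearZr. Qed.
HB.instance Definition _ v :=
  GRing.isLinear.Build R X R^o _ (pairing v) (pairing_linear v).

Fact rpairing_linear x : linear (rpairing x).
Proof. by move=> k v w; rewrite /rpairing linearDl linearZl. Qed.
HB.instance Definition _ x :=
  GRing.isLinear.Build R X R^o _ (rpairing x) (rpairing_linear x).

Lemma lfun_pairing v : exists f : 'Hom(X, R^o), forall x, f x = omega v x.
Proof. by exists (linfun (pairing v)) => x; rewrite lfunE. Qed.

Lemma psymplectic_inj v w : is_psymplectic omega ->
  (forall x, omega v x = omega w x) -> v = w.
Proof.
move=> [nd _ _] vw; apply/eqP; rewrite -subr_eq0 -memv0 -(eqP nd).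
apply/mem_orthovP => x _.
by rewrite linearDl/= linearNl vw subrr.
Qed.

Lemma compact_pairing_bounded K v : compact K ->
  exists2 l : R, 0 < l & forall x, K x -> omega v x <= l.
Proof.
move=> /compact_bounded[M [Mr hM]].
have [C C0 hC] := linear_bounded (pairing v).
exists (C * (`|M| + 1)); first by rewrite mulr_gt0// ltr_pwDr.
move=> x Kx; apply: le_trans (ler_norm _) _; apply: le_trans (hC x) _.
rewrite ler_pM2l//.
apply: (hM (`|M| + 1) _ x Kx).
by rewrite (le_lt_trans (ler_norm _))// ltrDl.
Qed.

Lemma sharpE (f : 'Hom(X, R^o)) v : is_psymplectic omega ->
  (forall x, f x = omega v x) -> sharp omega f = v.
Proof.
move=> om fv; apply: (psymplectic_inj om) => x; rewrite -fv.
exact/esym/(xgetPex 0 (ex_intro (fun v => forall x, f x = omega v x) v fv)).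
Qed.

(** With [pairing_le_dual_gauge] this identifies the dual gauge of [v] with the support function of
    [K] at [omega v]: for [l > 0], [v] lies in [l] times the dual body iff [omega v <= l] on [K]. *)
Lemma dual_gauge_le K v (l : R) : is_psymplectic omega -> 0 < l ->
  (forall x, K x -> omega v x <= l) -> dual_gauge omega K v <= l.
Proof.
move=> om l0 Kl; apply: ge_inf; first by exists 0 => ? [].
split; first exact: ltW.
exists (l^-1 *: v); last by rewrite scalerA mulfV ?gt_eqF// scale1r.
have [f fE] := lfun_pairing (l^-1 *: v).
exists f; last exact: sharpE.
by move=> x Kx; rewrite fE linearZl/= ler_pdivrMl// mulr1 Kl.
Qed.

Lemma pairing_le_dual_gauge K v x : is_psymplectic omega -> compact K ->
  K x -> omega v x <= dual_gauge omega K v.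
Proof.
move=> om cK Kx; apply: lb_le_inf.
  (* The set of scalars must be shown nonempty before its infimum is bounded below; any positive
     bound of [omega v] on [K] belongs to it. *)
  have [l l0 hl] := compact_pairing_bounded v cK.
  exists l; split; first exact: ltW.
  exists (l^-1 *: v); last by rewrite scalerA mulfV ?gt_eqF// scale1r.
  have [f fE] := lfun_pairing (l^-1 *: v).
  exists f; last exact: sharpE.
  by move=> z Kz; rewrite fE linearZl/= ler_pdivrMl// mulr1 hl.
move=> l [l0 [u [f Kf fu]] ->]; rewrite linearZl/= -[leRHS]mulr1 ler_wpM2l//.
(* If [f] had no representing vector, [sharp] would return 0, which pairs to 0 and satisfies the
   bound as well. *)
have [[w wE]|nw] := pselect (exists w, forall x, f x = omega w x).
  by rewrite -fu (sharpE om wE) -wE Kf.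
rewrite -fu /sharp xgetPN ?linear0l//.
by move=> w wE; apply: nw; exists w.
Qed.

(** A functional [f] defining the hyperplane is constant on [x + orth v], hence equals [f x] times
    [omega v]. Since [0] is in [K] and [f != 0], the factor [f x] is positive and can be divided
    out. *)
Lemma supports_pairing_le K x v : K 0 -> omega v x = 1 ->
    supports K x [set x + z | z in orth omega v] ->
  forall y, K y -> omega v y <= 1.
Proof.
move=> K0 vx [Kx [f f0 [H Kf]]] y Ky.
have fE z : f z = omega v z *: f x.
  have : [set x + z | z in orth omega v] (x + (z - omega v z *: x)).
    exists (z - omega v z *: x) => //.
    by rewrite /orth/= linearDr/= linearNr/= linearZr/= vx mulr1 subrr.
  rewrite H /= linearD linearB linearZ /= => /eqP.
  by rewrite eq_sym -subr_eq0 opprD addrA subrr add0r oppr_eq0 subr_eq0 => /eqP.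
have fx : 0 < (f x : R).
  rewrite lt_neqAle; have := Kf _ K0; rewrite linear0 => ->; rewrite andbT.
  apply: contra f0 => /eqP fx0; apply/eqP/lfunP => z.
  by rewrite fE -fx0 scaler0 lfunE.
by have := Kf _ Ky; rewrite fE /GRing.scale/= ger_pMl.
Qed.

Lemma pairing_le_supports K x v : K x -> omega v x = 1 ->
    (forall y, K y -> omega v y <= 1) ->
  supports K x [set x + z | z in orth omega v].
Proof.
move=> Kx vx Kv; split=> //; have [f fE] := lfun_pairing v.
exists f.
  apply/eqP => f0; have := fE x; rewrite f0 lfunE/= vx => /esym/eqP.
  by rewrite oner_eq0.
split; last by move=> y Ky; rewrite !fE vx Kv.
apply/seteqP; split=> z /=.
  by move=> [w vw <-]; rewrite !fE linearDr/= vw addr0.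
rewrite !fE => vz; exists (z - x); last by rewrite addrC subrK.
by rewrite /orth/= linearDr/= linearNr/= vz subrr.
Qed.

(** Smoothness identifies the hyperplanes of [v] and of [J x]. The pairings with [v] and [J x] then
    have the same kernel and both take the value 1 at [x], so they agree, and nondegeneracy
    concludes. *)
Lemma J_eq K x v : is_psymplectic omega -> smooth_body K -> boundary K x ->
  K x -> omega v x = 1 -> (forall y, K y -> omega v y <= 1) -> J omega K x = v.
Proof.
move=> om sK bx Kx vx Kv.
have vS := pairing_le_supports Kx vx Kv.
have [wS wx] := xgetPex 0 (ex_intro (fun v => _ /\ omega v x = 1) v (conj vS vx)).
rewrite -/(J omega K x) in wS wx.
have [H [_ uH]] := sK _ bx.
have vw : [set x + z | z in orth omega v] =
    [set x + z | z in orth omega (J omega K x)].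
  by rewrite -(uH _ vS) -(uH _ wS).
apply: (psymplectic_inj om) => y.
have : [set x + z | z in orth omega v] (x + (y - omega v y *: x)).
  exists (y - omega v y *: x) => //.
  by rewrite /orth/= linearDr/= linearNr/= linearZr/= vx mulr1 subrr.
rewrite vw => -[z] /[swap] /addrI -> /=.
by rewrite /orth/= linearDr/= linearNr/= linearZr/= wx mulr1 => /subr0_eq.
Qed.

(** A nonzero value is not the default of [xget], so it meets the specification of [J]. For a
    regular curve tangent to [J], this nonvanishing is automatic. *)
Lemma J_neq0_pairing K x : K 0 -> J omega K x != 0 ->
  omega (J omega K x) x = 1 /\ forall y, K y -> omega (J omega K x) y <= 1.
Proof.
move=> K0; rewrite /J; case: xgetP => [v -> [vS vx] _|_]; last by rewrite eqxx.
by split=> //; exact: supports_pairing_le vx vS.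
Qed.

End SymplecticPairing.

(** * Finite test families, propagation along segments, and integral comparison *)

(** Small multiples of a basis and their opposites lie in [K], and expanding in coordinates bounds a
    functional by its values on them. Finiteness lets the bounds hold simultaneously outside one
    null set. *)
Lemma nbhs0_test_family (R : realType) (X : normedVectType R) (K : set X) :
    K° 0 ->
  exists n (y : 'I_n -> X) (C : R), [/\ 0 < C, forall i, K (y i) /\ K (- y i) &
    forall (f : {linear X -> R^o}) (M : R),
      0 <= M -> (forall i, `|f (y i) : R| <= M) -> forall z, `|f z : R| <= C * `|z| * M].
Proof.
move=> /nbhs_ballP[r /= r0 rK].
have [D D0 hD] := @v2r_bounded R X.
pose b i : X := r2v (delta_mx 0 i).
pose B := 1 + \sum_i `|b i|.
have B0 : 0 < B by rewrite ltr_pwDl// sumr_ge0.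
pose rho := r / B.
have rho0 : 0 < rho by rewrite divr_gt0.
have rb i : `|rho *: b i| < r.
  rewrite normrZ gtr0_norm// /rho mulrAC ltr_pdivrMr// ltr_pM2l//.
  rewrite /B (bigD1 i)//= ltr_pwDl// lerDl; exact: sumr_ge0.
exists (dim X), (fun i => rho *: b i), (1 + (\sum_(i < dim X) 1) * D / rho).
split.
- by rewrite ltr_pwDl// !mulr_ge0 ?invr_ge0 ?sumr_ge0// ltW.
- move=> i; split; apply: rK; rewrite -ball_normE /= sub0r ?opprK ?normrN.
    exact: rb.
  exact: rb.
move=> f M M0 fM z; rewrite -{1}(v2rK z) (row_sum_delta (v2r z)) !linear_sum/=.
apply: le_trans (ler_norm_sum _ _ _) _.
apply: (@le_trans _ _ (\sum_(i < dim X) D * `|z| * (M / rho))).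
  apply: ler_sum => i _; rewrite linearZ/= linearZ/= normrM.
  apply: ler_pM => //.
    apply: le_trans (hD z); rewrite [leRHS]/Num.norm/= mx_normrE.
    by apply/bigmax_geP; right => /=; exists (ord0, i).
  rewrite ler_pdivlMr// mulrC -[rho in leLHS]gtr0_norm// -normrM.
  by have := fM i; rewrite linearZ.
have -> : \sum_(i < dim X) D * `|z| * (M / rho) =
    (\sum_(i < dim X) 1) * D / rho * `|z| * M.
  by rewrite -!mulrA mulr_suml; apply: eq_bigr => i _; rewrite mul1r; ring.
by rewrite !mulrDl !mul1r lerDr mulr_ge0.
Qed.

(** Let [S] collect the points [x] with [P a x]: the local property at [sup S] first reaches
    [sup S], then goes beyond it unless it is [b]. It serves to pass from local to global finiteness
    of an integral. *)
Lemma segment_local_trans (R : realType) (P : R -> R -> Prop) (a b : R) :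
    a <= b ->
    (forall p, p \in `[a, b] -> exists2 d, 0 < d &
      forall x y, p - d < x -> x <= y -> y < p + d -> P x y) ->
    (forall x y z, x <= y -> y <= z -> P x y -> P y z -> P x z) ->
  P a b.
Proof.
move=> ab loc tr.
pose S := [set x | x \in `[a, b] /\ P a x].
have aS : S a.
  split; first by rewrite bound_itvE.
  have [|d d0] := loc a; first by rewrite bound_itvE.
  by apply; rewrite ?ltrDl// ltrBlDr ltrDl.
have hS : has_sup S by split; [exists a|exists b => x [/itvP ->]].
have aS_le : a <= sup S by apply: ub_le_sup => //; case: hS.
have Sb_le : sup S <= b by apply: ge_sup; [case: hS|move=> x [/itvP ->]].
have [|d d0 hd] := loc (sup S); first by rewrite in_itv/= aS_le.
have [x [xab Pax] xd] := sup_adherent d0 hS.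
have xS : x <= sup S by apply: ub_le_sup; [case: hS|].
have PaS : P a (sup S).
  apply: tr Pax _ => //; first by rewrite (itvP xab).
  by apply: hd => //; rewrite ltrDl.
have [<-//|Sb] := eqVneq (sup S) b.
have Slt : sup S < b by rewrite lt_neqAle Sb.
pose y := Num.min b (sup S + d / 2).
have yb : y <= b by rewrite ge_min lexx.
have Sy : sup S < y by rewrite lt_min Slt ltrDl divr_gt0.
have Pay : P a y.
  apply: tr PaS _ => //; first exact: ltW.
  apply: hd; [by rewrite ltrBlDr ltrDl|exact: ltW|].
  by rewrite gt_min ltrD2l ltr_pdivrMr// ltr_pMr// ltr1n orbT.
have := ub_le_sup (proj2 hS) (conj _ Pay : S y).
rewrite leNgt Sy => /(_ _)/negP; rewrite in_itv/= yb andbT.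
by rewrite (le_trans aS_le (ltW Sy)) => /(_ isT isT).
Qed.

(** Both integrals are suprema over simple functions below the integrand. This form applies to the
    dual gauge of [c'] without a proof of its measurability. *)
Lemma ge0_le_integral_nomeas d (T : measurableType d) (R : realType)
    (mu : {measure set T -> \bar R}) (D : set T) (f g : T -> \bar R) :
    (forall x, D x -> 0 <= f x)%E -> (forall x, D x -> f x <= g x)%E ->
  (\int[mu]_(x in D) f x <= \int[mu]_(x in D) g x)%E.
Proof.
move=> f0 fg; rewrite !ge0_integralE//; last first.
  by move=> x Dx; apply: le_trans (f0 x Dx) (fg x Dx).
apply: le_ereal_sup => _ [h hf <-]; exists h => //= x.
apply: le_trans (hf x) _; rewrite /patch; case: ifPn => // xD.
by apply: fg; rewrite inE in xD.
Qed.

(** The finite integral of [f] cancels, so the nonnegative function [g - f] has integral 0. *)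
Lemma ge0_integral_eq_negligible d (T : measurableType d) (R : realType)
    (mu : {measure set T -> \bar R}) (D : set T) (f g : T -> R) :
    measurable D -> measurable_fun D f -> measurable_fun D g ->
    (forall x, D x -> 0 <= f x) -> (forall x, D x -> f x <= g x) ->
    (\int[mu]_(x in D) (f x)%:E < +oo)%E ->
    (\int[mu]_(x in D) (g x)%:E <= \int[mu]_(x in D) (f x)%:E)%E ->
  mu.-negligible [set x | D x /\ f x != g x].
Proof.
move=> mD mf mg f0 fg fi gf.
have h0 x : D x -> (0 <= (g x - f x)%:E)%E by move=> Dx; rewrite lee_fin subr_ge0 fg.
have mh : measurable_fun D (fun x => (g x - f x)%:E).
  by apply/measurable_EFinP; exact: measurable_funB.
have Hh : (\int[mu]_(x in D) `|(g x - f x)%:E| = 0)%E.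
  apply/eqP; rewrite eq_le integral_ge0// andbT.
  rewrite (eq_integral (fun x => (g x - f x)%:E)); last first.
    by move=> x; rewrite inE => Dx; rewrite gee0_abs// h0.
  rewrite -(@leeD2lE _ (\int[mu]_(x in D) (f x)%:E)%E).
    rewrite adde0 -ge0_integralD//.
    - apply: le_trans gf; rewrite le_eqVlt; apply/orP; left; apply/eqP.
      by apply: eq_integral => x _; rewrite -EFinD addrC subrK.
    - exact/measurable_EFinP.
  rewrite ge0_fin_numE// integral_ge0// => x Dx; by rewrite lee_fin f0.
have /ae_eq_integral_abs := Hh.
move=> /(_ mD mh); apply: negligibleS => x /= [Dx fgx] /(_ Dx)/=.
by case=> /eqP; rewrite subr_eq0 eq_sym (negbTE fgx).
Qed.

(** A negative derivative at [a] would make [h] drop just to the right of [a], against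
    Goldowsky-Tonelli. This recovers the sign at a prescribed point, even one in [N]. *)
Lemma ae_ger0_derive_right_end (R : realType) (h : R -> R) (N : set R)
    (a b : R) :
    a < b -> lebesgue_measure.-negligible N ->
    (forall x, x \in `[a, b] -> derivable h x 1) ->
    (forall x, x \in `[a, b] -> ~ N x -> 0 <= 'D_1 h x) ->
  0 <= 'D_1 h a.
Proof.
move=> ab N0 dh h'0; rewrite leNgt; apply/negP => h'a.
have dha : derivable h a 1 by apply: dh; rewrite bound_itvE ltW.
have : \forall y \near a^'+, - 'D_1 h a / 2 * (y - a) <= - h y + h a.
  have := @derivable_right_slope _ (- h) a (- 'D_1 h a / 2).
  rewrite deriveN// [X in _ -> _ -> X](_ : _ = (\forall y \near a^'+,
    - 'D_1 h a / 2 * (y - a) <= - h y + h a)).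
    by apply; [exact: derivableN|lra].
  by under eq_near do rewrite opprK.
move=> H.
suff: \forall y \near a^'+, False by move=> /filter_ex[].
near=> y.
have ay : a < y by near: y; exact: nbhs_right_gt.
have yb : y <= b by near: y; exact: nbhs_right_le.
have hay : h a <= h y.
  apply: (ae_ger0_derive_ndecr (ltW ay) N0) => x.
    by move=> xay; apply: dh; apply: subset_itvl xay; rewrite bnd_simp.
  by move=> xay; apply: h'0; apply: subset_itvl xay; rewrite bnd_simp.
have : - 'D_1 h a / 2 * (y - a) <= - h y + h a by near: y.
rewrite leNgt => /negP; apply.
have : 0 < - 'D_1 h a / 2 * (y - a) by apply: mulr_gt0; lra.
lra.
Unshelve. all: by end_near. Qed.

Lemma periodic_derive (R : realType) (X : normedModType R) (c : R -> X)
    (T t : R) : periodic c T -> 'D_1 c (t + T) = 'D_1 c t.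
Proof.
move=> cT; rewrite /derive cT.
by under eq_fun do rewrite /= addrA cT.
Qed.

Lemma periodic_ind (R : realType) (P : R -> Prop) (T : R) : 0 < T ->
    (forall t, P (t + T) <-> P t) -> (forall t, 0 <= t < T -> P t) ->
  forall t, P t.
Proof.
move=> T0 PT P0 t.
have PTn n : forall s, P (s + n%:R * T) <-> P s.
  elim: n => [|n IH] s; first by rewrite mul0r addr0.
  by rewrite -natr1 mulrDl mul1r addrA PT IH.
have PTz (k : int) s : P (s + k%:~R * T) <-> P s.
  case: k => n; first exact: PTn.
  by rewrite NegzE mulrNz mulNr -(PTn n.+1) subrK.
have -> : t = (t - (Num.floor (t / T))%:~R * T) + (Num.floor (t / T))%:~R * T.
  by rewrite subrK.
apply/PTz/P0; rewrite subr_ge0 -ler_pdivlMr// ge_floor/=.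
rewrite ltrBlDl -[X in _ + X]mul1r -mulrDl -ltr_pdivrMr//.
by have := lt_succ_floor (t / T); rewrite intrD.
Qed.

Lemma compact_boundary_mem (R : realType) (X : normedVectType R) (K : set X)
    (x : X) :
  compact K -> boundary K x -> K x.
Proof.
move=> cK []; rewrite -(closure_id _).1//.
exact: compact_closed (@norm_hausdorff _ _) cK.
Qed.

(** * The pairing of [c'] with points of [K] along the curve *)

Section Curve.
Variables (R : realType) (X : normedVectType R) (omega : {skew_symmetric X}).
Variables (K : set X) (c : R -> X).
Hypotheses (symp_omega : is_psymplectic omega) (cK : compact K) (K0 : K° 0).
Hypotheses (c_on_K : forall t, boundary K (c t)) (diff_c : differentiable_curve c).
Hypothesis pos_c : positively_parametrized omega c.

Local Notation f t := (omega ('D_1 c t) (c t)).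
Local Notation g t := (dual_gauge omega K ('D_1 c t)).
Local Notation I := (`[0, 2 * pi]%classic : set R).

Let mem0 : K 0. Proof. exact: interior_subset K0. Qed.

Let mem_c t : K (c t).
Proof. exact: compact_boundary_mem. Qed.

Let continuous_c : continuous c.
Proof. by move=> t; apply: differentiable_continuous; exact/derivable1_diffP. Qed.

Lemma is_derive_pairing (y : X) (t : R) :
  is_derive t 1 (fun s => omega (c s) y) (omega ('D_1 c t) y).
Proof. exact: (@is_derive_linear _ _ (rpairing omega y)). Qed.

Lemma measurable_pairing_derive (D : set R) (y : X) : measurable D ->
  measurable_fun D (fun t => omega ('D_1 c t) y).
Proof.
move=> mD; have -> : (fun t => omega ('D_1 c t) y) =
    (fun t => 'D_1 (fun s => omega (c s) y) t).
  by apply/funext => t; have [_ ->] := is_derive_pairing y t.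
by apply: measurable_derive => // t; have [] := is_derive_pairing y t.
Qed.

(** In a basis, [f] is a finite sum of continuous coordinates of [c] times derivatives of real
    functions. *)
Lemma measurable_pairing (D : set R) : 
  measurable D -> measurable_fun D (fun t => f t).
Proof.
move=> mD.
have -> : (fun t => f t) = (fun t => \sum_(i < \dim {:X})
    (coord (vbasis {:X}) i (c t) : R) * omega ('D_1 c t) (vbasis {:X})`_i).
  apply/funext => t; rewrite [in LHS](coord_vbasis (memvf (c t))) linear_sumr.
  by apply: eq_bigr => i _; rewrite linearZr.
apply: measurable_sum => i; apply: measurable_funM; last first.
  exact: measurable_pairing_derive.
apply: measurable_funTS; apply: continuous_measurable_fun => t.
apply: (@continuous_comp _ _ _ c (coord (vbasis {:X}) i)).
  exact: continuous_c.
exact: linear_continuous_vect.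
Qed.

(** The test inequalities bound the functional [omega ('D_1 c t)] by a multiple of [f t], so
    replacing [c t] by [c p] costs at most [C * |c t - c p| * f t]. The error is relative to [f t],
    hence harmless even where [c'] is unbounded. *)
Lemma pairing_near : exists n (y : 'I_n -> X),
  (forall i, K (y i) /\ K (- y i)) /\
  forall (p e : R), 0 < e -> exists2 d : R, 0 < d & forall t, `|p - t| < d ->
    (forall i, omega ('D_1 c t) (y i) <= f t /\
               omega ('D_1 c t) (- y i) <= f t) ->
    (1 - e) * f t <= omega ('D_1 c t) (c p).
Proof.
have [n [y [C [C0 Ky hC]]]] := nbhs0_test_family K0.
exists n, y; split=> // p e e0.
have eC : 0 < e / C by rewrite divr_gt0.
have /cvgrPdist_lt/(_ _ eC)[d /= d0 hd] := @continuous_c p.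
exists d => // t pt yt.
have fy i : `|pairing omega ('D_1 c t) (y i) : R| <= f t.
  have [h1 h2] := yt i; rewrite ler_norml /pairing lerNl h1 andbT.
  by rewrite -linearN.
have h1 := hC _ _ (ltW (pos_c t)) fy (c t - c p).
have h2 := le_trans (ler_norm _) h1.
have h3 : C * `|c t - c p| <= e.
  by rewrite mulrC -ler_pdivlMr// distrC; apply/ltW/hd.
have h4 : C * `|c t - c p| * f t <= e * f t by rewrite ler_pM2r.
have : omega ('D_1 c t) (c t - c p) = f t - omega ('D_1 c t) (c p).
  by rewrite linearDr/= linearNr.
by move: h2 h4; rewrite /pairing => h2 h4 h5; lra.
Qed.

Lemma characteristic_pairing_le : regular_curve c ->
    (forall t, 'D_1 c t \in <[J omega K (c t)]>%VS) ->
  forall t y, K y -> omega ('D_1 c t) y <= f t.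
Proof.
move=> rc cJ t y Ky; have /vlineP[k kJ] := cJ t.
have J0 : J omega K (c t) != 0.
  by apply: contraNneq (rc t) => J0; rewrite kJ J0 scaler0.
have [Jc JK] := J_neq0_pairing mem0 J0.
have := pos_c t; rewrite kJ !linearZl/= Jc mulr1 => k0.
by rewrite ger_pMr// JK.
Qed.

Lemma pairingZB (v x z : X) (k : R) :
  omega v (k *: x - z) = k * omega v x - omega v z.
Proof. by rewrite linearDr linearZr linearNr. Qed.

Lemma area_eq_length_pairing_le (t : R) (y : X) :
    (2 * symplectic_area omega c)%:E = dual_length omega K c ->
  0 <= t < 2 * pi -> K y -> omega ('D_1 c t) y <= f t.
Proof.
rewrite /symplectic_area /dual_length /Rintegral mulrA divff ?mul1r// => fg.
move=> /andP[t0 t2] Ky.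
pose mu : {measure set (measurableTypeR R) -> \bar R} := lebesgue_measure.
have aeF := ae_filter_ringOfSetsType mu.
have f0 s : I s -> (0 <= (f s)%:E)%E.
  by move=> _; rewrite lee_fin; exact/ltW/pos_c.
have le_fg s : f s <= g s by exact: pairing_le_dual_gauge.
have le_int : (\int[mu]_(s in I) (f s)%:E <= \int[mu]_(s in I) (g s)%:E)%E.
  by apply: ge0_le_integral_nomeas => // s _; rewrite lee_fin.
(* The area is a real number by definition, so the hypothesis makes the length finite; the integral
   of [f] lies below it. *)
have f_lty : (\int[mu]_(s in I) (f s)%:E < +oo)%E.
  by apply: le_lt_trans le_int _; rewrite -fg ltry.
have f_fin : (\int[mu]_(s in I) (f s)%:E)%E \is a fin_num.
  by rewrite ge0_fin_numE// integral_ge0.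
(* The measurable function [max (f s) (omega ('D_1 c s) z)] lies between [f] and [g], so its
   integral is that of [f] and it equals [f] almost everywhere. *)
have ae_le z : K z -> {ae mu, forall s, I s -> omega ('D_1 c s) z <= f s}.
  move=> Kz.
  have mI : measurable I by [].
  have mf : measurable_fun I (fun s => f s) by exact: measurable_pairing.
  have := @ge0_integral_eq_negligible _ _ R mu I (fun s => f s)
    (fun s => Num.max (f s) (omega ('D_1 c s) z)) mI mf.
  move=> /(_ _ _ _ f_lty _)[].
  - by apply: measurable_maxr => //; exact: measurable_pairing_derive.
  - by move=> s _; exact/ltW/pos_c.
  - by move=> s _; rewrite le_max lexx.
  - rewrite -[leRHS]fineK// fg; apply: ge0_le_integral_nomeas => s Is.
      by rewrite lee_fin le_max ltW ?pos_c.
    by rewrite lee_fin ge_max le_fg pairing_le_dual_gauge.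
  move=> N [mN N0 NI]; exists N; split=> // s /= /not_implyP[Is].
  move=> /negP; rewrite -ltNge => fs; apply: NI; split=> //=.
  by rewrite (max_idPr (ltW fs)) lt_eqF.
have [n [yy [Kyy near_c]]] := pairing_near.
have aeN : {ae mu, forall s, I s -> omega ('D_1 c s) y <= f s /\
    forall i : 'I_n, omega ('D_1 c s) (yy i) <= f s /\
                     omega ('D_1 c s) (- yy i) <= f s}.
  have H : {ae mu, forall s, forall i : 'I_n, I s ->
      omega ('D_1 c s) (yy i) <= f s /\ omega ('D_1 c s) (- yy i) <= f s}.
    apply: (@filter_forall _ _ (fun (i : 'I_n) s => I s ->
      omega ('D_1 c s) (yy i) <= f s /\ omega ('D_1 c s) (- yy i) <= f s)
      (almost_everywhere mu) aeF) => i.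
    have [K1 K2] := Kyy i.
    by apply: (@filterS2 _ _ aeF _ _ _ _ (ae_le _ K1) (ae_le _ K2)) => s h1 h2 Is;
      split; [exact: h1|exact: h2].
  apply: (@filterS2 _ _ aeF _ _ _ _ (ae_le _ Ky) H) => s h1 h2 Is; split; first exact: h1.
  by move=> i; exact: h2.
apply/ler_addgt0Pr => e0 e0_gt0.
have ft := pos_c t.
pose e := e0 / f t.
have e_gt0 : 0 < e by rewrite divr_gt0.
have -> : f t + e0 = (1 + e) * f t by rewrite mulrDl mul1r divfK// gt_eqF.
have e1 : 0 < 1 + e by rewrite addr_gt0.
(* The tolerance [e / (1 + e)] is chosen so that [(1 + e) * (1 - e / (1 + e)) = 1]. *)
have [d d0 hd] := near_c t _ (divr_gt0 e_gt0 e1).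
(* As [t < 2 * pi], there is room to the right of [t] inside the interval of integration. *)
pose b := Num.min (2 * pi) (t + d / 2).
have tb : t < b by rewrite lt_min t2 ltrDl divr_gt0.
have := @ae_ger0_derive_right_end _
  (fun s => omega (c s) ((1 + e) *: c t - y)) _ _ _ tb aeN.
have [_ ->] := is_derive_pairing ((1 + e) *: c t - y) t.
rewrite pairingZB subr_ge0; apply.
  by move=> s _; have [] := is_derive_pairing ((1 + e) *: c t - y) s.
move=> s; rewrite in_itv/= le_min => /and3P[ts s2 sd] /contrapT.
have Is : I s by rewrite /= in_itv/= s2 (le_trans t0 ts).
move=> /(_ Is)[ys yys].
have [_ ->] := is_derive_pairing ((1 + e) *: c t - y) s.
rewrite pairingZB subr_ge0.
apply: le_trans ys _.
have -> : f s = (1 + e) * ((1 - e / (1 + e)) * f s).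
  by field; rewrite gt_eqF.
by rewrite ler_pM2l//; apply: hd => //; rewrite ltr_norml; lra.
Qed.

(** * Length and finite area when [c t] maximizes the pairing on [K] *)

Hypothesis le_f : forall t y, K y -> omega ('D_1 c t) y <= f t.

Lemma dual_gauge_derive t : g t = f t.
Proof.
apply/eqP; rewrite eq_le; apply/andP; split.
  by apply: dual_gauge_le => //; exact: le_f.
exact: pairing_le_dual_gauge.
Qed.

Lemma pairing_integral_lty (a b : R) : a <= b ->
  (\int[lebesgue_measure]_(t in `[a, b]) (f t)%:E < +oo)%E.
Proof.
move=> ab.
apply: (@segment_local_trans _ (fun a b =>
  (\int[lebesgue_measure]_(t in `[a, b]) (f t)%:E < +oo)%E) _ _ ab).
  move=> p _; have [n [y [Ky hy]]] := pairing_near.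
  have [|d d0 hd] := hy p 2^-1; first by rewrite invr_gt0.
  exists d => // u v pu uv vp.
  have [->|nuv] := eqVneq u v.
    by rewrite set_itv1 integral_set1 ltry.
  (* The tolerance [1/2] gives the factor 2. Going past [v], up to the midpoint of [v] and [p + d],
     leaves the room on the right that the difference quotients require. *)
  have fF t : t \in `[u, (v + (p + d)) / 2] ->
      f t <= omega ('D_1 c t) (2 *: c p).
    rewrite in_itv/= => tuv; rewrite linearZr/=.
    have : (1 - 2^-1) * f t <= omega ('D_1 c t) (c p).
      apply: hd; first by rewrite ltr_norml; lra.
      by move=> i; have [K1 K2] := Ky i; split; exact: le_f.
    lra.
  apply: (@le_lt_trans _ _ (\int[lebesgue_measure]_(t in `[u, v])
    ('D_1 (fun s => omega (c s) (2 *: c p)) t)%:E)%E).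
    apply: ge0_le_integral_nomeas => t /=; rewrite in_itv/= => tuv.
      by rewrite lee_fin ltW.
    rewrite lee_fin; have [_ ->] := is_derive_pairing (2 *: c p) t.
    by apply: fF; rewrite in_itv/=; lra.
  apply: (@ge0_derive_integral_lty _ _ _ _ ((v + (p + d)) / 2)).
  - by rewrite lt_neqAle nuv.
  - lra.
  - by move=> t; have [] := is_derive_pairing (2 *: c p) t.
  - move=> t tuv; have [_ ->] := is_derive_pairing (2 *: c p) t.
    by apply: le_trans (fF _ tuv); exact: ltW.
move=> x y z xy yz fxy fyz.
have -> : `[x, z]%classic = `[x, y]%classic `|` `]y, z]%classic.
  apply/seteqP; split=> t /=; rewrite !in_itv/=.
    by move=> /andP[-> ->]; case: (leP t y); [left|right].
  by case=> /andP[h1 h2]; lra.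
rewrite ge0_integral_setU//.
- apply: lte_add_pinfty => //; apply: le_lt_trans fyz.
  apply: ge0_subset_integral => //.
  + by apply/measurable_EFinP; exact: measurable_pairing.
  + by move=> t _; rewrite lee_fin; exact/ltW/pos_c.
  + by move=> t /=; rewrite !in_itv/= => /andP[/ltW-> ->].
- by apply/measurable_EFinP; apply: measurable_pairing; exact: measurableU.
- by move=> t _; rewrite lee_fin; exact/ltW/pos_c.
- apply/disj_setPS => t [] /=; rewrite !in_itv/= => /andP[_ ty] /andP[].
  by rewrite ltNge ty.
Qed.

End Curve.

Theorem theorem7p3 (R : realType) (X : normedVectType R)
  (even_dim : ~~ odd (\dim {: X}))
  (omega : {skew_symmetric X}) (symp_omega : is_psymplectic omega)
  (K : set X) (convex_K : convex_body K) (smooth_K : smooth_body K)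
  (K0 : K° 0)
  (c : R -> X) (circle_c : circle_map c) (c_on_K : forall t, boundary K (c t))
  (diff_c : differentiable_curve c) (regular_c : regular_curve c)
  (simple_c : simple_curve c) (pos_c : positively_parametrized omega c) :
  closed_characteristic omega K c <->
  (2 * symplectic_area omega c)%:E = dual_length omega K c.
Proof.
move: (convex_K) => [cK _ _].
split.
  move=> [_ _ rc _ cJ].
  have le_f := characteristic_pairing_le K0 pos_c rc cJ.
  have pi2 : 0 <= 2 * pi :> R by rewrite mulr_ge0// pi_ge0.
  have lty := pairing_integral_lty K0 diff_c pos_c le_f pi2.
  rewrite /symplectic_area /dual_length /Rintegral mulrA divff ?mul1r//.
  (* Finiteness excludes the case where [fine] would turn an infinite area into 0. *)
  rewrite fineK ?ge0_fin_numE//; last first.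
    by apply: integral_ge0 => t _; rewrite lee_fin; exact/ltW/pos_c.
  apply: eq_integral => t _.
  by rewrite (dual_gauge_derive symp_omega cK c_on_K pos_c le_f).
move=> E; split=> //.
have pi2 : 0 < 2 * pi :> R by rewrite mulr_gt0// pi_gt0.
apply: (periodic_ind pi2) => [t|t tpi].
  by rewrite periodic_derive// circle_c.
have le_f y :=
  @area_eq_length_pairing_le _ _ _ _ _ symp_omega cK K0 c_on_K diff_c pos_c t y
    E tpi.
have ft := pos_c t.
have Kt := compact_boundary_mem cK (c_on_K t).
(* Maximality says that [c'], scaled to pair to 1 with [c t], defines a supporting hyperplane. *)
have -> : J omega K (c t) = (omega ('D_1 c t) (c t))^-1 *: 'D_1 c t.
  apply: J_eq => //; first by rewrite linearZl/= mulVf// gt_eqF.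
  by move=> y Ky; rewrite linearZl/= ler_pdivrMl// mulr1 le_f.
apply/vlineP; exists (omega ('D_1 c t) (c t)).
by rewrite scalerA mulfV ?scale1r// gt_eqF.
Qed.
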